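(* Let $K$ be an algebraic extension of $\mathbb{Q}$, let $E/K$ be an elliptic curve, and let $p$ and $q$ be distinct primes. Let $\ell$ be a prime such that $\ell \mid \gcd\big([K(E[p]):K],[K(E[q]):K]\big)$. Then there exists a field $L$ with $K\subseteq L\subseteq K(E[pq])$ such that $T_{p,q}(E/L)\cong \mathbb{Z}/\ell\mathbb{Z}$.
   Context: All fields lie in a fixed algebraic closure $\bar K$. For an integer $n$, $K(E[n])$ is the $n$-torsion field of $E$ over $K$ (the field obtained by adjoining the coordinates of the $n$-torsion points of $E$ to $K$). For an algebraic extension $L/K$, the $(p,q)$-entanglement group is $T_{p,q}(E/L)=\operatorname{Gal}\big(L(E[p])\cap L(E[q])/L\big)$. *)

(* Defs.v *)
From HB Require Import structures.
From mathcomp Require Import all_boot all_algebra.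
From mathcomp Require Import boolp.

Set Implicit Arguments.
Unset Strict Implicit.
Unset Printing Implicit Defensive.

Import GRing.Theory.
Local Open Scope ring_scope.

(** Subfields of a field [C] are the bundled predicates [divringClosed C]: [C] being a field,
    closure under [1], subtraction and division is closure under the field
    operations. *)

Definition subfield_sort (C : fieldType) (F : divringClosed C) : Type :=
  {x : C | x \in F}.

HB.instance Definition _ (C : fieldType) (F : divringClosed C) :=
  SubChoice.on (subfield_sort F).
HB.instance Definition _ (C : fieldType) (F : divringClosed C) :=
  [SubChoice_isSubComUnitRing of subfield_sort F by <:].
HB.instance Definition _ (C : fieldType) (F : divringClosed C) :=
  [SubComUnitRing_isSubIntegralDomain of subfield_sort F by <:].
HB.instance Definition _ (C : fieldType) (F : divringClosed C) :=
  [SubIntegralDomain_isSubField of subfield_sort F by <:].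

Definition image_field (K C : fieldType) (f : {rmorphism K -> C}) : {pred C} :=
  [pred z | `[< exists x : K, f x = z >]].

Lemma image_field_divring_closed (K C : fieldType) (f : {rmorphism K -> C}) :
  divring_closed (image_field f).
Proof.
split=> [|x y|x y].
- by apply/asboolP; exists 1; rewrite rmorph1.
- move=> /asboolP[a <-] /asboolP[b <-].
  by apply/asboolP; exists (a - b); rewrite rmorphB.
- move=> /asboolP[a <-] /asboolP[b <-].
  by apply/asboolP; exists (a / b); rewrite fmorph_div.
Qed.

HB.instance Definition _ (K C : fieldType) (f : {rmorphism K -> C}) :=
  GRing.isDivringClosed.Build C (image_field f) (image_field_divring_closed f).

Definition cap_field (C : fieldType) (F M : divringClosed C) : {pred C} :=
  [predI F & M].

Lemma cap_field_divring_closed (C : fieldType) (F M : divringClosed C) :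
  divring_closed (cap_field F M).
Proof.
split=> [|x y|x y]; rewrite !inE ?rpred1 //.
- by move=> /andP[Fx Mx] /andP[Fy My]; rewrite !rpredB.
- by move=> /andP[Fx Mx] /andP[Fy My]; rewrite !rpred_div.
Qed.

HB.instance Definition _ (C : fieldType) (F M : divringClosed C) :=
  GRing.isDivringClosed.Build C (cap_field F M) (cap_field_divring_closed F M).

(** [F(S)], the intersection of all subfields of [C] containing [F] and [S]. *)
Definition adjoin_field (C : fieldType) (F : divringClosed C) (S : C -> Prop) :
    {pred C} :=
  [pred z | `[< forall M : divringClosed C, {subset F <= M} ->
                (forall s, S s -> s \in M) -> z \in M >]].

Lemma adjoin_field_divring_closed (C : fieldType) (F : divringClosed C)
    (S : C -> Prop) :
  divring_closed (adjoin_field F S).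
Proof.
split=> [|x y|x y].
- by apply/asboolP => M _ _; rewrite rpred1.
- move=> /asboolP Hx /asboolP Hy; apply/asboolP => M FM SM.
  by rewrite rpredB ?Hx ?Hy.
- move=> /asboolP Hx /asboolP Hy; apply/asboolP => M FM SM.
  by rewrite rpred_div ?Hx ?Hy.
Qed.

HB.instance Definition _ (C : fieldType) (F : divringClosed C) (S : C -> Prop) :=
  GRing.isDivringClosed.Build C (adjoin_field F S)
    (adjoin_field_divring_closed F S).

(** [field_degree F M n]: [[M : F] = n], i.e. [M] has an [F]-basis with [n]
    elements. It is meant for [F] contained in [M]. *)
Definition field_degree (C : fieldType) (F M : divringClosed C) (n : nat) : Prop :=
  exists b : 'I_n -> C,
    [/\ forall i, b i \in M,
        forall z, z \in M ->
          exists2 c : 'I_n -> C,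
            forall i, c i \in F & z = \sum_(i < n) c i * b i
      & forall c : 'I_n -> C, (forall i, c i \in F) ->
          \sum_(i < n) c i * b i = 0 -> forall i, c i = 0].

(** [Gal(F / L)]: the field automorphisms of [F] fixing [F ∩ L] pointwise. The
    inverse is carried as data; it is determined by [gal_fun] ([gal_eqP]), and
    [f 1 = 1] follows from bijectivity. *)
Record gal (C : fieldType) (L F : divringClosed C) := Gal {
  gal_fun :> subfield_sort F -> subfield_sort F;
  gal_inv : subfield_sort F -> subfield_sort F;
  gal_funK : cancel gal_fun gal_inv;
  gal_invK : cancel gal_inv gal_fun;
  gal_add : {morph gal_fun : x y / x + y};
  gal_mul : {morph gal_fun : x y / x * y};
  gal_fix : forall x : subfield_sort F, val x \in L -> gal_fun x = x
}.

Lemma gal_eqP (C : fieldType) (L F : divringClosed C) (s t : gal L F) :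
  s =1 t -> s = t.
Proof.
case: s t => [f f' fK f'K fD fM fL] [g g' gK g'K gD gM gL] /= /funext fg.
rewrite -{g}fg in gK g'K gD gM gL *.
have f'g' : f' = g' by apply/funext => x; rewrite -{1}[x]g'K fK.
rewrite -{g'}f'g' in gK g'K *.
by congr Gal; apply: Prop_irrelevance.
Qed.

Definition gal_one (C : fieldType) (L F : divringClosed C) : gal L F :=
  @Gal C L F id id (fun=> erefl) (fun=> erefl) (fun _ _ => erefl)
    (fun _ _ => erefl) (fun _ _ => erefl).

Definition gal_comp (C : fieldType) (L F : divringClosed C) (s t : gal L F) :
  gal L F.
Proof.
apply: (@Gal C L F (s \o t) (gal_inv t \o gal_inv s)).
- exact: can_comp (gal_funK s) (gal_funK t).
- exact: can_comp (gal_invK t) (gal_invK s).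
- by move=> x y /=; rewrite !gal_add.
- by move=> x y /=; rewrite !gal_mul.
- by move=> x Lx /=; rewrite !gal_fix.
Defined.

Definition gal_inverse (C : fieldType) (L F : divringClosed C) (s : gal L F) :
  gal L F.
Proof.
apply: (@Gal C L F (gal_inv s) s).
- exact: gal_invK.
- exact: gal_funK.
- by move=> x y; apply: (can_inj (gal_funK s)); rewrite gal_add !gal_invK.
- by move=> x y; apply: (can_inj (gal_funK s)); rewrite gal_mul !gal_invK.
- by move=> x Lx; apply: (can_inj (gal_funK s)); rewrite gal_invK gal_fix.
Defined.

HB.instance Definition _ (C : fieldType) (L F : divringClosed C) :=
  gen_eqMixin (gal L F).
HB.instance Definition _ (C : fieldType) (L F : divringClosed C) :=
  gen_choiceMixin (gal L F).

Lemma gal_compA (C : fieldType) (L F : divringClosed C) :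
  associative (@gal_comp C L F).
Proof. by move=> s t u; apply: gal_eqP. Qed.

Lemma gal_comp1s (C : fieldType) (L F : divringClosed C) :
  left_id (gal_one L F) (@gal_comp C L F).
Proof. by move=> s; apply: gal_eqP. Qed.

Lemma gal_comps1 (C : fieldType) (L F : divringClosed C) :
  right_id (gal_one L F) (@gal_comp C L F).
Proof. by move=> s; apply: gal_eqP. Qed.

Lemma gal_compVs (C : fieldType) (L F : divringClosed C) :
  left_inverse (gal_one L F) (@gal_inverse C L F) (@gal_comp C L F).
Proof. by move=> s; apply: gal_eqP => x /=; rewrite gal_funK. Qed.

Lemma gal_compsV (C : fieldType) (L F : divringClosed C) :
  right_inverse (gal_one L F) (@gal_inverse C L F) (@gal_comp C L F).
Proof. by move=> s; apply: gal_eqP => x /=; rewrite gal_invK. Qed.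

HB.instance Definition _ (C : fieldType) (L F : divringClosed C) :=
  isGroup.Build (gal L F) (@gal_compA C L F) (@gal_comp1s C L F)
    (@gal_comps1 C L F) (@gal_compVs C L F) (@gal_compsV C L F).

Definition group_isom_zmod (G : groupType) (A : zmodType) : Prop :=
  exists2 f : G -> A, bijective f & forall s t, f (s * t)%g = f s + f t.

(** [y^2 + a1 x y + a3 y = x^3 + a2 x^2 + a4 x + a6] *)
Record weierstrass (F : Type) := Weierstrass {
  wa1 : F; wa2 : F; wa3 : F; wa4 : F; wa6 : F
}.

Definition discriminant (F : fieldType) (E : weierstrass F) : F :=
  let: Weierstrass a1 a2 a3 a4 a6 := E in
  let b2 := a1 ^+ 2 + 4 * a2 in
  let b4 := 2 * a4 + a1 * a3 in
  let b6 := a3 ^+ 2 + 4 * a6 in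
  let b8 := a1 ^+ 2 * a6 + 4 * a2 * a6 - a1 * a3 * a4 + a2 * a3 ^+ 2 - a4 ^+ 2 in
  - b2 ^+ 2 * b8 - 8 * b4 ^+ 3 - 27 * b6 ^+ 2 + 9 * b2 * b4 * b6.

Record elliptic_curve (F : fieldType) := EllipticCurve {
  weierstrass_eq :> weierstrass F;
  discriminant_neq0 : discriminant weierstrass_eq != 0
}.

Definition base_change (K C : Type) (f : K -> C) (E : weierstrass K) :
    weierstrass C :=
  let: Weierstrass a1 a2 a3 a4 a6 := E in
  Weierstrass (f a1) (f a2) (f a3) (f a4) (f a6).

(** Points of the projective plane that are affine or the point at infinity
    [[0 : 1 : 0]]; membership in the curve is the separate predicate
    [on_curve]. *)
Inductive point (F : Type) := Infinity | Affine (x y : F).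
Arguments Infinity {F}.

Definition on_curve (F : fieldType) (E : weierstrass F) (P : point F) : bool :=
  let: Weierstrass a1 a2 a3 a4 a6 := E in
  if P is Affine x y then
    y ^+ 2 + a1 * x * y + a3 * y == x ^+ 3 + a2 * x ^+ 2 + a4 * x + a6
  else true.

(** The chord-tangent law, on points of the curve: [lam] is the slope of the
    line through [P] and [Q] (the tangent at [P] if [P = Q]); in the second
    branch [Q = - P]. *)
Definition add_point (F : fieldType) (E : weierstrass F) (P Q : point F) :
    point F :=
  let: Weierstrass a1 a2 a3 a4 a6 := E in
  match P, Q with
  | Infinity, _ => Q
  | _, Infinity => P
  | Affine x1 y1, Affine x2 y2 =>
      if (x1 == x2) && (y1 + y2 + a1 * x2 + a3 == 0) then Infinity
      else
        let lam :=
          if x1 == x2 then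
            (3 * x1 ^+ 2 + 2 * a2 * x1 + a4 - a1 * y1) / (2 * y1 + a1 * x1 + a3)
          else (y2 - y1) / (x2 - x1) in
        let x3 := lam ^+ 2 + a1 * lam - a2 - x1 - x2 in
        let y3 := - (lam + a1) * x3 - (y1 - lam * x1) - a3 in
        Affine x3 y3
  end.

Definition mul_point (F : fieldType) (E : weierstrass F) (n : nat) (P : point F) :
    point F :=
  iter n (add_point E P) Infinity.

Definition is_torsion (F : fieldType) (E : weierstrass F) (n : nat)
    (P : point F) : Prop :=
  on_curve E P /\ mul_point E n P = Infinity.

Definition torsion_coordinate (F : fieldType) (E : weierstrass F) (n : nat)
    (z : F) : Prop :=
  exists x y, is_torsion E n (Affine x y) /\ (z = x \/ z = y).

(** [L(E[n])] for an elliptic curve [E] over [K] and a subfield [L] of the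
    algebraic closure [C] of [K]; the torsion points are those of [E(C)]. *)
Definition torsion_field (K : fieldType) (C : closedFieldType)
    (iota : {rmorphism K -> C}) (E : elliptic_curve K) (L : divringClosed C)
    (n : nat) : divringClosed C :=
  adjoin_field L (torsion_coordinate (base_change iota E) n).

(** [T_{p,q}(E/L) = Gal(L(E[p]) ∩ L(E[q]) / L)] *)
Definition entanglement_group (K : fieldType) (C : closedFieldType)
    (iota : {rmorphism K -> C}) (E : elliptic_curve K) (L : divringClosed C)
    (p q : nat) : groupType :=
  gal L (cap_field (torsion_field iota E L p) (torsion_field iota E L q)).

(* Main.v *)
Require Import Defs.
From HB Require Import structures.
From mathcomp Require Import all_boot all_algebra all_fingroup all_solvable.
From mathcomp Require Import all_field.
From mathcomp Require Import boolp.

(** Put [A = K(E[p])], [B = K(E[q])] and let [P], [Q] be the subgroups of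
    [G = Gal(AB/K)] fixing [A] and [B], so that [P ∩ Q = 1]. If [L] is the fixed
    field of [H <= G], then [L(E[p]) ∩ L(E[q])] is the fixed field of the group
    generated by [H ∩ P] and [H ∩ Q]. An [l]-Sylow subgroup of [G] lies in neither
    [P] nor [Q], hence contains some [h] outside [P ∪ Q]; replace [h] by the last of
    [h, h^l, h^(l^2), ...] outside [P ∪ Q], and take [H = <h>]. If, say, [h^l] is in
    [Q], then [H ∩ P], a proper subgroup of the cyclic [l]-group [H], lies in
    [<h^l> <= Q], hence is trivial, while [H ∩ Q = <h^l>] has index [l] in [H].
    Nothing is used about torsion except that the set of [n]-torsion coordinates is
    stable under conjugation over [K]. *)

Set Implicit Arguments.
Unset Strict Implicit.
Unset Printing Implicit Defensive.

Import GRing.Theory.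

(** * Cyclic subgroups of prime relative index *)

Section GroupTheory.
Local Open Scope group_scope.

(** If [S] were inside [P], then [#|S| * l] would divide [#|P| * #|G : P| = #|G|], although [#|S|]
    is already the full [l]-part of [#|G|]. *)
Lemma Sylow_not_sub_dvd_index (gT : finGroupType) (l : nat) (G S P : {group gT}) :
  (l.-Sylow(G) S) -> P \subset G -> l %| #|G : P| -> prime l -> ~~ (S \subset P).
Proof.
move=> sylS sPG dvd_l pr_l; apply/negP => sSP.
have : (#|S| * l)%N %| #|G|.
  by rewrite -(Lagrange sPG) dvdn_mul // cardSg.
rewrite (card_Hall sylS) p_part -expnSr pfactor_dvdn ?cardG_gt0 //.
by rewrite ltnn.
Qed.

(** A group is never the union of two proper subgroups: if [a] lies in [Q] but not in [P], and [b]
    in [P] but not in [Q], then [a * b] lies in neither. *)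
Lemma notin_two_subgroups (gT : finGroupType) (S P Q : {group gT}) :
  ~~ (S \subset P) -> ~~ (S \subset Q) ->
  exists2 h, h \in S & (h \notin P) && (h \notin Q).
Proof.
move=> /subsetPn[a Sa nPa] /subsetPn[b Sb nQb].
have [Qa|nQa] := boolP (a \in Q); last by exists a => //; rewrite nPa.
have [Pb|nPb] := boolP (b \in P); last by exists b => //; rewrite nPb.
exists (a * b); first by rewrite groupM.
by rewrite groupMr // groupMl // nPa.
Qed.

Lemma cycle_prime_index (gT : finGroupType) (l : nat) (h : gT) (P Q : {group gT}) :
  prime l -> (l.-elt h) -> (P :&: Q = 1) ->
  h \notin P -> h \notin Q -> (h ^+ l) \in Q ->
  (<[h]> :&: P = 1) /\ #|<[h]> : <[h]> :&: Q| = l.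
Proof.
move=> pr_l l_h tiPQ nPh nQh Qhl.
(* If [l] does not divide [m], then [h ^+ m] generates [<[h]>]; a group that misses [h] therefore
   contains only powers of [h] with exponent divisible by [l]. *)
have sub_proper (R : {group gT}) : h \notin R -> (<[h]> :&: R \subset <[h ^+ l]>).
  move=> nRh; apply/subsetP => x /setIP[/cycleP[m ->] Rhm].
  have [/dvdnP[k ->]|ndvd_l] := boolP (l %| m).
    by rewrite mulnC expgM mem_cycle.
  case/negP: nRh; have: generator <[h]> (h ^+ m).
    rewrite generator_coprime; have [n ->] := p_natP l_h.
    by rewrite coprimeXl // prime_coprime.
  by move/eqP => gen; have := cycle_id h; rewrite gen; apply: subsetP; rewrite cycle_subG.
have sQ : (<[h ^+ l]> \subset Q) by rewrite cycle_subG.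
split.
  apply/trivgP; rewrite -tiPQ; apply/subsetP => x hPx.
  have := subsetP (sub_proper P nPh) x hPx => /(subsetP sQ) Qx.
  by case/setIP: hPx => _ Px; rewrite inE Px.
have -> : (<[h]> :&: Q = <[h ^+ l]>).
  by apply/eqP; rewrite eqEsubset sub_proper // subsetI cycleX.
(* Since [h] is not in [P], it is not 1, so its order is a positive power of [l]; this makes the
   index of [<[h ^+ l]>] equal to [l] and not 1. *)
have dvd_l : l %| #[h].
  have [[|n] oh] := p_natP l_h; last by rewrite oh expnS dvdn_mulr.
  by move/eqP: oh nPh; rewrite order_eq1 => /eqP->; rewrite group1.
rewrite -divgS ?cycleX // -!orderE orderXdiv // divnA // mulKn //.
Qed.

Lemma exists_cyclic_prime_index (gT : finGroupType) (l : nat) (G P Q : {group gT}) :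
  prime l -> P \subset G -> Q \subset G -> (P :&: Q = 1) ->
  l %| #|G : P| -> l %| #|G : Q| ->
  exists2 h, h \in G &
     ((<[h]> :&: P = 1 /\ #|<[h]> : <[h]> :&: Q| = l)
   \/ (<[h]> :&: Q = 1 /\ #|<[h]> : <[h]> :&: P| = l)).
Proof.
move=> pr_l sPG sQG tiPQ dvdP dvdQ.
have [S sylS] := Sylow_exists l G.
have [h0 Sh0 nh0] := notin_two_subgroups
  (Sylow_not_sub_dvd_index sylS sPG dvdP pr_l)
  (Sylow_not_sub_dvd_index sylS sQG dvdQ pr_l).
have sSG := pHall_sub sylS.
have l_h0 : (l.-elt h0) := mem_p_elt (pHall_pgroup sylS) Sh0.
pose PQ k := (h0 ^+ (l ^ k)%N \in P) || (h0 ^+ (l ^ k)%N \in Q).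
have exPQ : exists k, PQ k.
  have [n oh] := p_natP l_h0; exists n.
  by rewrite /PQ -oh expg_order group1.
(* The minimum is not 0 because [h0] avoids [P] and [Q]. When it is [k.+1], the element
   [h0 ^+ (l ^ k)] still avoids both, while its [l]-th power lies in one of them. *)
case: (ex_minnP exPQ) => -[|k] PQk mink.
  by move: PQk nh0; rewrite /PQ expn0 expg1 -negb_or => ->.
have : ~~ PQ k by apply/negP => /mink; rewrite ltnn.
rewrite negb_or => /andP[nP nQ].
exists (h0 ^+ (l ^ k)%N); first by rewrite (subsetP sSG) // groupX.
have l_h := p_eltX (l ^ k)%N l_h0.
move: PQk; rewrite /PQ expnSr expgM => /orP[inP|inQ]; [right|left].
  by apply: cycle_prime_index; rewrite // setIC.
exact: cycle_prime_index.
Qed.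

End GroupTheory.

Local Open Scope ring_scope.

(** * Entanglement inside a splitting field *)

Section Entangle.
Variables (K : fieldType) (M : splittingFieldType K).
Implicit Types (A B E L U V : {subfield M}).

Lemma prodv_subE U V E : (U * V <= E)%VS = (U <= E)%VS && (V <= E)%VS.
Proof.
apply/idP/andP => [sUVE|[sUE sVE]]; last exact: prodv_sub.
by split; apply: subv_trans sUVE; rewrite ?field_subvMr ?field_subvMl.
Qed.

(** By the Galois connection, [x] fixes [W] exactly when [W] lies in the fixed field of [x], and a
    field contains a compositum as soon as it contains both factors. *)
Lemma gal_prodv E U V : (U <= E)%VS -> (V <= E)%VS ->
  'Gal(E / U * V)%g = ('Gal(E / U) :&: 'Gal(E / V))%g.
Proof.
move=> sUE sVE; apply/setP => x; have sUVE : ((U * V)%AS <= E)%VS by exact: prodv_sub.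
have galE (W : {subfield M}) : (W <= E)%VS ->
    (x \in 'Gal(E / W)%g) = (W <= fixedField [set x])%VS.
  by move=> sWE; rewrite -(galois_connection [set x] sWE) sub1set.
by rewrite inE !galE // prodv_subE.
Qed.

Lemma normalField_prodv U A B :
  normalField U A -> normalField U B -> normalField U (A * B).
Proof.
move=> /forall_inP nA /forall_inP nB; apply/forall_inP => f fU.
by rewrite aimgM (eqP (nA f fU)) (eqP (nB f fU)).
Qed.

(** Both Galois groups have order the degree of [E], over [U] and over [A], so the index is a
    quotient of degrees in a tower; [A] may fail to be normal over [U]. *)
Lemma galois_index U A E : galois U E -> (U <= A <= E)%VS ->
  #|'Gal(E / U) : 'Gal(E / A)|%g = \dim_U A.
Proof.
move=> galE sUAE; have galAE := galoisS sUAE galE; have [sUA sAE] := andP sUAE.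
have sUE := subv_trans sUA sAE.
rewrite -divgS ?galS // -!galois_dim //.
rewrite (dim_sup_field sAE) mulnK ?adim_gt0 // (dim_sup_field sUA) mulnA.
rewrite !mulnK ?adim_gt0 // mulKn //.
by rewrite -(dim_sup_field sUA) divn_gt0 ?adim_gt0 ?dimvS.
Qed.

Lemma sub_gal_fixedField L A E : galois L E -> (L <= A <= E)%VS ->
  fixedField 'Gal(E / A)%g = A.
Proof. by move=> galE sLAE; apply/galois_fixedField; apply: galoisS galE. Qed.

(** The group of [E] over [L * A] is [<[h]> :&: 'Gal(E / A)], which is trivial, so [L * A = E] and
    the intersection is just [L * B]. Its degree is then the given index. *)
Lemma galois_prodv_cyclic_fixedField A B E (h : gal_of E) (l : nat)
    (L := fixedField_aspace <[h]>%g) :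
  (A <= E)%VS -> (B <= E)%VS -> (<[h]> :&: 'Gal(E / A) = 1)%g ->
  #|<[h]> : <[h]> :&: 'Gal(E / B)|%g = l ->
  galois L ((L * A) :&: (L * B)) /\ \dim_L ((L * A) :&: (L * B)) = l.
Proof.
move=> sAE sBE tiA ixB.
(* Artin's theorem: [E] is Galois over the fixed field of any group of its automorphisms. *)
have galLE : galois L E by exact: fixedField_galois.
have galEL : 'Gal(E / L)%g = <[h]>%g by exact: gal_fixedField.
have sLE : (L <= E)%VS := fixedField_bound _.
have galA : 'Gal(E / L * A)%g = 1%g by rewrite gal_prodv // galEL.
have galB : 'Gal(E / L * B)%g = (<[h]> :&: 'Gal(E / B))%g by rewrite gal_prodv // galEL.
have sLAE : (L <= (L * A)%AS <= E)%VS by rewrite field_subvMr prodv_sub.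
have sLBE : (L <= (L * B)%AS <= E)%VS by rewrite field_subvMr prodv_sub.
have LA_E : (L * A)%VS = E.
  rewrite -[LHS](sub_gal_fixedField galLE sLAE) /= galA.
  apply/eqP; rewrite eqEsubv fixedField_bound /=; apply/subvP => a Ea.
  by apply/fixedFieldP => // x /set1P->; rewrite gal_id.
have -> : ((L * A) :&: (L * B) = L * B)%VS.
  by apply/capv_idPr; rewrite LA_E; case/andP: sLBE.
split; last first.
  by rewrite -(galois_index galLE sLBE) /= galEL galB.
(* Every subgroup of the abelian group [<[h]>] is normal, so [L * B] is Galois over [L]. *)
have nsB : ('Gal(E / (L * B)%AS) <| 'Gal(E / L))%g.
  rewrite /= galB galEL; by rewrite -sub_abelian_normal ?cycle_abelian ?subsetIl.
by have := normal_fixedField_galois galLE nsB; rewrite (sub_gal_fixedField galLE sLBE).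
Qed.

Lemma exists_cyclic_entanglement A B (l : nat) :
    [pchar K] =i pred0 -> prime l ->
    normalField 1 A -> normalField 1 B -> (l %| \dim A)%N -> (l %| \dim B)%N ->
  exists L : {subfield M},
    [/\ (L <= A * B)%VS, galois L ((L * A) :&: (L * B))
      & \dim_L ((L * A) :&: (L * B)) = l].
Proof.
move=> char0 pr_l nA nB dvdA dvdB; pose E := (A * B)%AS.
have galE : galois 1 E.
  rewrite /galois sub1v normalField_prodv // andbT; apply/separableP => x _.
  by apply: pcharf0_separable => p; rewrite pchar_lalg char0.
have [sAE sBE] : (A <= E)%VS /\ (B <= E)%VS by rewrite field_subvMr field_subvMl.
have ix (C : {subfield M}) : (C <= E)%VS -> #|'Gal(E / 1) : 'Gal(E / C)|%g = \dim C.
  by move=> sCE; rewrite (galois_index galE) ?sub1v //= dimv1 divn1.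
have ti : ('Gal(E / A) :&: 'Gal(E / B) = 1)%g.
  rewrite -gal_prodv //; apply/trivgP/subsetP => x.
  rewrite (gal_kHom _ (subvv E)) => /kAHomP fix_x.
  by apply/set1P/eqP/gal_eqP => a Ea; rewrite gal_id fix_x.
have := @exists_cyclic_prime_index _ l 'Gal(E / 1)%G 'Gal(E / A)%G 'Gal(E / B)%G
  pr_l (galS E (sub1v A)) (galS E (sub1v B)) ti.
rewrite !ix // => /(_ dvdA dvdB)[h _ [] [tih ixh]].
  exists (fixedField_aspace <[h]>%g).
  have [galL dimL] := galois_prodv_cyclic_fixedField sAE sBE tih ixh.
  by split=> //; apply: fixedField_bound.
exists (fixedField_aspace <[h]>%g); rewrite capvC.
have [galL dimL] := galois_prodv_cyclic_fixedField sBE sAE tih ixh.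
by split=> //; apply: fixedField_bound.
Qed.
End Entangle.

(** * Finite splitting fields inside an algebraic closure *)

Definition preim_field (M C : fieldType) (j : {rmorphism M -> C})
    (F : divringClosed C) : {pred M} := [pred z | j z \in F].

Lemma preim_field_divring_closed (M C : fieldType) (j : {rmorphism M -> C})
    (F : divringClosed C) : divring_closed (preim_field j F).
Proof.
split=> [|x y|x y]; rewrite !inE ?rmorph1 ?rpred1 //.
- by move=> Fx Fy; rewrite rmorphB rpredB.
- by move=> Fx Fy; rewrite fmorph_div rpred_div.
Qed.

HB.instance Definition _ (M C : fieldType) (j : {rmorphism M -> C})
    (F : divringClosed C) :=
  GRing.isDivringClosed.Build M (preim_field j F) (preim_field_divring_closed j F).

Definition map_field (M C : fieldType) (j : {rmorphism M -> C})
    (F : divringClosed M) : {pred C} :=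
  [pred w | `[< exists2 z, z \in F & j z = w >]].

Lemma map_field_divring_closed (M C : fieldType) (j : {rmorphism M -> C})
    (F : divringClosed M) : divring_closed (map_field j F).
Proof.
split=> [|_ _ /asboolP[a Fa <-] /asboolP[b Fb <-]
         |_ _ /asboolP[a Fa <-] /asboolP[b Fb <-]]; apply/asboolP.
- by exists 1; rewrite ?rpred1 ?rmorph1.
- by exists (a - b); rewrite ?rpredB ?rmorphB.
- by exists (a / b); rewrite ?rpred_div ?fmorph_div.
Qed.

HB.instance Definition _ (M C : fieldType) (j : {rmorphism M -> C})
    (F : divringClosed M) :=
  GRing.isDivringClosed.Build C (map_field j F) (map_field_divring_closed j F).

Lemma mem_map_field (M C : fieldType) (j : {rmorphism M -> C})
    (F : divringClosed M) z : (j z \in map_field j F) = (z \in F).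
Proof.
by apply/asboolP/idP => [[y Fy /fmorph_inj<-]|Fz] //; exists z.
Qed.

Lemma sub_adjoin_field (C : fieldType) (F : divringClosed C) (S : C -> Prop) :
  {subset F <= adjoin_field F S}.
Proof. by move=> z Fz; apply/asboolP => M FM _; apply: FM. Qed.

Lemma gen_adjoin_field (C : fieldType) (F : divringClosed C) (S : C -> Prop) z :
  S z -> z \in adjoin_field F S.
Proof. by move=> Sz; apply/asboolP => M _; apply. Qed.

Lemma adjoin_field_sub (C : fieldType) (F G : divringClosed C) (S : C -> Prop) :
  {subset F <= G} -> (forall z, S z -> z \in G) -> {subset adjoin_field F S <= G}.
Proof. by move=> FG SG z /asboolP; apply. Qed.

Section Embedding.
Variables (K : fieldType) (C : closedFieldType) (iota : {rmorphism K -> C}).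
Hypothesis char0 : [pchar K] =i pred0.
Hypothesis algC : forall z : C, algebraicOver iota z.

(** Irreducibility amounts to having least size among the nonzero polynomials vanishing at [z], so a
    polynomial of least size is chosen. *)
Lemma minimal_poly_exists (z : C) : exists p : {poly K},
  [/\ p != 0, root (map_poly iota p) z & irreducible_poly p].
Proof.
pose P n :=
  `[< exists p : {poly K}, [/\ p != 0, root (map_poly iota p) z & size p = n] >].
have exP : exists n, P n.
  by have [p nz_p pz] := algC z; exists (size p); apply/asboolP; exists p.
case: (ex_minnP exP) => n /asboolP[p [nz_p pz sz_p]] minn; exists p; split=> //.
apply/(subfx_irreducibleP pz nz_p) => q qz nz_q; rewrite sz_p.
by apply: minn; apply/asboolP; exists q.
Qed.

(** Two generators at a time are merged by the primitive element theorem in characteristic 0. The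
    merged one is an integral combination, so it stays in [F]; taking [F] to be K(s) then gives a
    [z] generating nothing more than [s] does. *)
Lemma primitive_element (F : divringClosed C) (s : seq C) :
  {subset s <= F} -> exists2 z, z \in F &
    forall x, x \in s -> exists p : {poly K}, (map_poly iota p).[z] = x.
Proof.
elim: s => [_|x s IHs /allP/= /andP[Fx /allP sF]]; first by exists 1; rewrite ?rpred1.
have [y Fy s_y] := IHs sF.
have [[p nz_p px] [q nz_q qy]] := (algC x, algC y).
have [n [[u Du] [v Dv]]] := pchar0_PET nz_p px nz_q qy char0.
exists (y *+ n - x); first by rewrite rpredB ?rpredMn.
move=> t /[!inE] /orP[/eqP->|/s_y[r <-]]; first by exists u.
(* An earlier element is [r] evaluated at [y], and [y] is [v] evaluated at the new generator. *)
by exists (r \Po v); rewrite map_comp_poly horner_comp Dv.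
Qed.

(** K(s) is rebuilt abstractly as K[X]/(r), with [r] the minimal polynomial of a primitive element
    [z], and embedded by sending the class of X to [z]. *)
Lemma fieldExt_embedding (s : seq C) :
  exists (M : fieldExtType K) (j : {rmorphism M -> C}) (s1 : seq M),
    [/\ forall a, j a%:A = iota a, map j s1 = s & <<1 & s1>>%VS = fullv].
Proof.
pose F : divringClosed C := adjoin_field (image_field iota) (fun z => z \in s).
have [z Fz s_z] : exists2 z, z \in F &
    forall x, x \in s -> exists p : {poly K}, (map_poly iota p).[z] = x.
  by apply: primitive_element => x s_x; apply: gen_adjoin_field.
have [r [nz_r rz irr_r]] := minimal_poly_exists z.
pose M : fieldExtType K := SubFieldExtType rz irr_r.
pose j : {rmorphism M -> C} := @subfx_inj _ _ iota z r.
pose z1 : M := subfx_root iota z r.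
have jK a : j a%:A = iota a by exact: (subfx_inj_base rz nz_r).
have jz1 : j z1 = z by exact: subfx_inj_root.
have jhorner (p : {poly K}) : j (map_poly (in_alg M) p).[z1] = (map_poly iota p).[z].
  rewrite -horner_map jz1 -map_poly_comp; congr _.[z].
  by apply: eq_map_poly => a /=; rewrite jK.
have [s1 s1E] : exists s1 : seq M, map j s1 = s.
  elim: (s) s_z => [|x t IHt] t_z; first by exists [::].
  have [|t1 <-] := IHt; first by move=> y ty; apply: t_z; rewrite inE ty orbT.
  have [p <-] := t_z x (mem_head _ _).
  by exists ((map_poly (in_alg M) p).[z1] :: t1); rewrite /= jhorner.
exists M, j, s1; split=> //; apply/vspaceP => x; rewrite memvf.
(* The image under [j] of the field generated by [s1] contains K and [s], hence K(s), hence [z];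
   injectivity of [j] brings this back to [z1]. *)
have z1_s1 : z1 \in <<1 & s1>>%AS.
  rewrite -(mem_map_field j) jz1; apply: adjoin_field_sub Fz => [_ /asboolP[a <-]|y].
    by rewrite -jK mem_map_field rpredZ ?rpred1.
  by rewrite -s1E => /mapP[y1 s1y ->]; rewrite mem_map_field seqv_sub_adjoin.
have [p ->] := subfxEroot rz nz_r x.
apply: rpred_horner => //; apply/polyOverP => i; rewrite coef_map.
by apply: memvZ; apply: (mem1v <<1 & s1>>%AS).
Qed.

(** The elements of [s] are roots of one nonzero polynomial over [K], a product of annihilating
    polynomials. Adjoining all its roots in [C] gives a splitting field whose image contains [s]. *)
Lemma splittingField_embedding (s : seq C) :
  exists (M : splittingFieldType K) (j : {rmorphism M -> C}),
    (forall a, j a%:A = iota a) /\ (forall x, x \in s -> exists y, j y = x).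
Proof.
have [p [nz_p ps]] : exists p : {poly K},
    p != 0 /\ forall x, x \in s -> root (map_poly iota p) x.
  elim: s => [|x t [p [nz_p pt]]]; first by exists 1; rewrite oner_eq0.
  have [q nz_q qx] := algC x; exists (q * p); split; first by rewrite mulf_neq0.
  by move=> y /[!inE] /orP[/eqP->|/pt py]; rewrite rmorphM /= rootM ?qx ?py ?orbT.
have [rs Dp] := closed_field_poly_normal (map_poly iota p).
have [M [j [rs1 [jK Drs genM]]]] := fieldExt_embedding rs.
have jp : map_poly j (map_poly (in_alg M) p) = map_poly iota p.
  by rewrite -map_poly_comp; apply: eq_map_poly => a /=; rewrite jK.
have split_p : splitting_field_axiom M.
  exists (map_poly (in_alg M) p).
    by apply/polyOverP => i; rewrite coef_map /= rpredZ ?rpred1.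
  (* The factorisation is known over [C], and associate polynomials are detected after applying
     [j]. *)
  exists rs1 => //; rewrite -(eqp_map j) jp Dp.
  rewrite rmorph_prod -Drs big_map.
  under [X in _ %= X]eq_bigr do rewrite rmorphB /= map_polyX map_polyC.
  by rewrite eqp_scale // lead_coef_eq0 map_poly_eq0.
pose Ms : splittingFieldType K := HB.pack (FieldExt.sort M)
  (FieldExt_isSplittingField.Build K M split_p).
exists Ms, j; split=> // x /ps px.
have : x \in rs.
  by move: px; rewrite Dp rootZ ?root_prod_XsubC // lead_coef_eq0 map_poly_eq0.
by rewrite -Drs => /mapP[y _ ->]; exists y.
Qed.

End Embedding.

(** * Transfer along an embedding *)

(** Among the vector subspaces contained in [F], one of largest dimension is all of [F]: adding the
    line through a missing element would enlarge it within [F]. *)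
Lemma divringClosed_subfield (K : fieldType) (M : fieldExtType K) (F : divringClosed M) :
  (forall a : K, a%:A \in F) -> exists U : {subfield M}, U =i F.
Proof.
move=> KF; pose P n := `[< exists2 U : {vspace M}, \dim U = n & {subset U <= F} >].
have FZ a x : x \in F -> a *: x \in F.
  by move=> Fx; rewrite -mulr_algl rpredM.
have exP : exists n, P n.
  exists 0%N; apply/asboolP; exists 0%VS => [|x]; rewrite ?dimv0 // memv0.
  by move/eqP->; rewrite rpred0.
have leP n : P n -> (n <= \dim {:M})%N.
  by move=> /asboolP[U <- _]; rewrite dimvS ?subvf.
case: (ex_maxnP exP leP) => n /asboolP[U dimU sUF] maxn.
have UF : U =i F.
  move=> x; apply/idP/idP => [/sUF //|Fx]; apply/negPn/negP => nUx.
  have /maxn : P (\dim (U + <[x]>)%VS).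
    apply/asboolP; exists (U + <[x]>)%VS => // _ /memv_addP[u Uu [v /vlineP[a ->] ->]].
    by apply: rpredD; [exact: sUF|exact: FZ].
  rewrite -dimU leqNgt => /negP; apply.
  rewrite (ltn_leqif (dimv_leqif_eq (addvSl U _))); apply: contra nUx => /eqP->.
  by rewrite memvE addvSr.
have aspU : is_aspace U.
  apply/andP; split; first by apply: has_algid1; rewrite UF rpred1.
  by apply/prodvP => u v; rewrite !UF => Fu Fv; rewrite rpredM.
by exists (ASpace aspU).
Qed.

Section Transfer.
Variables (K : fieldType) (C : fieldType) (iota : {rmorphism K -> C}).

Lemma field_degree_dimv (M : fieldExtType K) (j : {rmorphism M -> C})
    (U : {subfield M}) (F : divringClosed C) (n : nat) :
  (forall a, j a%:A = iota a) -> (forall w, w \in F <-> w \in map_field j U) ->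
  field_degree (image_field iota) F n -> \dim U = n.
Proof.
move=> jK FU [b [Fb spanb freeb]].
have [b1 b1E] : exists b1 : 'I_n -> M, forall i, b1 i \in U /\ j (b1 i) = b i.
  have [|b1 Hb1] := @choice _ _ (fun i y => y \in U /\ j y = b i).
    by move=> i; have /FU/asboolP[z Uz jz] := Fb i; exists z.
  by exists b1.
have jsum (c : 'I_n -> K) : j (\sum_i c i *: b1 i) = \sum_i iota (c i) * b i.
  rewrite rmorph_sum; apply: eq_bigr => i _.
  by rewrite -mulr_algl rmorphM /= jK (b1E i).2.
pose X := [tuple b1 i | i < n].
have XE (i : 'I_n) : X`_i = b1 i by rewrite -tnth_nth tnth_mktuple.
suff : basis_of U X by move/size_basis.
apply/andP; split.
  rewrite eqEsubv; apply/andP; split.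
    by apply/span_subvP => _ /tnthP[i ->]; rewrite tnth_mktuple; case: (b1E i).
  apply/subvP => u Uu; have /spanb[c Kc jc] : j u \in F.
    by apply/FU; rewrite mem_map_field.
  have [c1 c1E] : exists c1 : 'I_n -> K, forall i, iota (c1 i) = c i.
    have [|c1 Hc1] := @choice _ _ (fun i y => iota y = c i); last by exists c1.
    by move=> i; have /asboolP := Kc i.
  have -> : u = \sum_i c1 i *: b1 i.
    by apply: (fmorph_inj j); rewrite jsum jc; apply: eq_bigr => i _; rewrite c1E.
  by apply: memv_suml => i _; rewrite memvZ // memv_span // -XE mem_nth ?size_tuple.
apply/freeP => k k0 i; apply: (fmorph_inj iota); rewrite rmorph0.
apply: (freeb (fun i => iota (k i))) => [i0|]; first by apply/asboolP; exists (k i0).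
rewrite -jsum -(rmorph0 j) -[in RHS]k0; congr (j _).
by apply: eq_bigr => i0 _; rewrite XE.
Qed.

End Transfer.

(** * Galois groups in [M] and automorphisms of image fields in [C] *)

Section GaloisTransfer.
Variables (K C : fieldType).
Variables (M : splittingFieldType K) (j : {rmorphism M -> C}).
Variables (L F : {subfield M}) (jL jF : divringClosed C).
Hypothesis jLE : forall w, w \in jL <-> w \in map_field j L.
Hypothesis jFE : forall w, w \in jF <-> w \in map_field j F.
Hypothesis sLF : (L <= F)%VS.

(** The correspondence is kept as a relation because preimages under [j] are only known to exist. *)
Let conj (s : Defs.gal jL jF) (x : gal_of F) : Prop :=
  forall (u : subfield_sort jF) z, val u = j z -> z \in F -> val (s u) = j (x z).

Let lift (u : subfield_sort jF) : exists2 z, z \in F & val u = j z.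
Proof. by have /jFE/asboolP[z Fz <-] := valP u; exists z. Qed.

Let jsub z : z \in F -> exists u : subfield_sort jF, val u = j z.
Proof.
move=> Fz; have jz : j z \in jF by apply/jFE; rewrite mem_map_field.
by exists (exist _ (j z) jz).
Qed.

Lemma gal_of_galois (x : gal_of F) :
  x \in 'Gal(F / L)%g -> exists s : Defs.gal jL jF, conj s x.
Proof.
have ex (y : gal_of F) : exists f : subfield_sort jF -> subfield_sort jF,
    forall u z, val u = j z -> z \in F -> val (f u) = j (y z).
  have [|f Hf] := @choice _ _ (fun u v : subfield_sort jF =>
      exists2 z, z \in F & val u = j z /\ val v = j (y z)).
    move=> u; have [z Fz uz] := lift u.
    by have [v vE] := jsub (memv_gal y Fz); exists v, z.
  exists f => u z uz Fz; have [z' _ [uz' ->]] := Hf u.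
  by congr (j (y _)); apply: (fmorph_inj j); rewrite -uz.
move=> Gx; have [[f fE] [g gE]] := (ex x, ex x^-1%g).
have fK : cancel f g.
  move=> u; apply: val_inj; have [z Fz uz] := lift u.
  by rewrite (gE _ _ (fE _ _ uz Fz)) ?memv_gal // -galM // mulgV gal_id.
have gK : cancel g f.
  move=> u; apply: val_inj; have [z Fz uz] := lift u.
  by rewrite (fE _ _ (gE _ _ uz Fz)) ?memv_gal // -galM // mulVg gal_id.
have fD : {morph f : u v / u + v}.
  move=> u v; apply: val_inj; have [[y Fy uy] [z Fz vz]] := (lift u, lift v).
  rewrite raddfD /= (fE _ _ uy Fy) (fE _ _ vz Fz) -rmorphD /= -linearD /=.
  by apply: fE; rewrite ?rpredD // raddfD /= uy vz rmorphD.
have fM : {morph f : u v / u * v}.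
  move=> u v; apply: val_inj; have [[y Fy uy] [z Fz vz]] := (lift u, lift v).
  rewrite rmorphM /= (fE _ _ uy Fy) (fE _ _ vz Fz) -rmorphM /= -rmorphM /=.
  by apply: fE; rewrite ?rpredM // rmorphM /= uy vz rmorphM.
have fL u : val u \in jL -> f u = u.
  move=> /jLE/asboolP[z Lz zu]; apply: val_inj.
  by rewrite (fE u z) ?(subvP sLF) // (fixed_gal sLF Gx Lz).
by exists (Defs.Gal fK gK fD fM fL).
Qed.

Lemma galois_of_gal (s : Defs.gal jL jF) :
  exists2 x, x \in 'Gal(F / L)%g & conj s x.
Proof.
(* [s] acts only on the image of [F], whereas [kHom] concerns linear endomorphisms of [M]; so [s] is
   preceded by the linear projection of [M] onto [F]. *)
have [|f fE] := @choice _ _ (fun z w : M => exists u : subfield_sort jF,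
    [/\ w \in F, val u = j (projv F z) & val (s u) = j w]).
  move=> z; have [u uE] := jsub (memv_proj F z).
  by have [w Fw wE] := lift (s u); exists w, u.
have valDM (u v w : subfield_sort jF) : val (u * v + w) = val u * val v + val w by [].
have flin : linear f.
  move=> a y z; apply: (fmorph_inj j).
  have [u [_ uE <-]] := fE (a *: y + z).
  have [v [_ vE vw]] := fE y; have [w [_ wE ww]] := fE z.
  have Fa : a%:A \in F by rewrite rpredZ ?rpred1.
  have [t tE] := jsub Fa.
  have -> : u = t * v + w.
    apply: val_inj; rewrite valDM uE vE wE tE linearP /= -[a *: projv F y]mulr_algl.
    by rewrite rmorphD rmorphM.
  (* A scalar of [K] is an element of [L], hence fixed by [s], so multiplicativity gives linearity
     over [K]. *)
  rewrite gal_add Defs.gal_mul [s t]gal_fix ?tE; last first.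
    by apply/jLE; rewrite mem_map_field rpredZ ?rpred1.
  by rewrite valDM tE vw ww -[a *: f y]mulr_algl rmorphD rmorphM.
pose fl : {linear M -> M} := HB.pack f (GRing.isLinear.Build K M M _ f flin).
pose f' : 'End(M) := linfun fl.
have f'E z (u : subfield_sort jF) : z \in F -> val u = j z -> val (s u) = j (f' z).
  move=> Fz uz; rewrite lfunE /=; have [v [_ vE <-]] := fE z.
  by congr (val (s _)); apply: val_inj; rewrite vE uz projv_id.
have homf : kHom L F f'.
  apply/kHomP_tmp; split=> [z Lz|y z Fy Fz].
    have Fz := subvP sLF z Lz; have [u uE] := jsub Fz.
    apply: (fmorph_inj j); rewrite -(f'E _ u) // gal_fix // uE.
    by apply/jLE; rewrite mem_map_field.
  have [[u uE] [v vE]] := (jsub Fy, jsub Fz).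
  apply: (fmorph_inj j); rewrite rmorphM /= -(f'E _ _ Fy uE) -(f'E _ _ Fz vE).
  by rewrite -rmorphM -Defs.gal_mul; apply/esym/f'E; rewrite ?rpredM // !rmorphM /= uE vE.
have autf : kAut L F f'.
  rewrite kAutE homf; apply/subvP => _ /memv_imgP[z Fz ->].
  by rewrite lfunE /=; have [u []] := fE z.
have [x Gx fx] := kAut_to_gal autf; exists x => // u z uz Fz.
by rewrite (f'E _ _ Fz uz) fx.
Qed.

Lemma gal_isom_Zp (l : nat) : prime l -> #|'Gal(F / L)%g| = l ->
  group_isom_zmod (Defs.gal jL jF) 'Z_l.
Proof.
move=> pr_l cardG.
have [|g cycG] := cyclicP (prime_cyclic _ : cyclic 'Gal(F / L)%g).
  by rewrite cardG.
have og : #[g]%g = l by rewrite orderE -cycG.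
(* ['Z_l] is truncated to have at least two elements; it is the integers modulo [l] because [l]
   exceeds 1. *)
have lE : (Zp_trunc l).+2 = l by rewrite Zp_cast ?prime_gt1.
have [|f fE] := @choice _ _ (fun s (k : 'Z_l) => conj s (g ^+ k)%g).
  move=> s; have [x] := galois_of_gal s.
  rewrite cycG => /cyclePmin[k]; rewrite og -{1}lE => ltk -> sk.
  by exists (Ordinal ltk).
have conj_gal s t x : conj s x -> conj t x -> s = t.
  move=> sx tx; apply: Defs.gal_eqP => u; apply: val_inj.
  by have [z Fz uz] := lift u; rewrite (sx _ _ uz Fz) (tx _ _ uz Fz).
have conj_inj s x y : conj s x -> conj s y -> x = y.
  move=> sx sy; apply/eqP/galois.gal_eqP => z Fz; apply: (fmorph_inj j).
  by have [u uz] := jsub Fz; rewrite -(sx _ _ uz Fz) (sy _ _ uz Fz).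
have modE n : (n %% (Zp_trunc l).+2 = n %% #[g]%g)%N by rewrite lE og.
have gX_inj (k m : 'Z_l) : (g ^+ k)%g = (g ^+ m)%g -> k = m.
  move=> /eqP; rewrite eq_expg_mod_order -!modE !modn_small // => /eqP.
  exact: val_inj.
have Gg k : (g ^+ k)%g \in 'Gal(F / L)%g by rewrite cycG mem_cycle.
exists f; last first.
  move=> s t; apply: gX_inj; apply: (conj_inj (s * t)%g); first exact: fE.
  move=> u z uz Fz; have -> : (g ^+ (f s + f t)%R = g ^+ f t * g ^+ f s)%g.
    by rewrite -expgD addnC /= modE expg_mod_order.
  by rewrite galM //; apply: (fE s); rewrite ?memv_gal //; apply: (fE t).
have [h hE] := choice (fun k : 'Z_l => gal_of_galois (Gg k)).
exists h => [s|k]; first by apply: (conj_gal _ _ (g ^+ f s)%g); [exact: hE|exact: fE].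
by apply: gX_inj; apply: (conj_inj (h k)); [exact: fE|exact: hE].
Qed.

End GaloisTransfer.

(** * Fields generated by conjugation-stable sets *)

Section EntangledField.
Variables (K : fieldType) (C : closedFieldType) (iota : {rmorphism K -> C}).

(** Conjugation is expressed by two K-embeddings of one field [M], so that an automorphism of [M]
    can be used without extending it to [C]. *)
Definition conjugation_stable (S : C -> Prop) : Prop :=
  forall (M : fieldType) (g : {rmorphism K -> M}) (j j' : {rmorphism M -> C}),
    (forall a, j (g a) = iota a) -> (forall a, j' (g a) = iota a) ->
    (forall w, S w -> exists z, j z = w) ->
  forall z, S (j z) -> S (j' z).

Section Pullback.
Variables (M : splittingFieldType K) (j : {rmorphism M -> C}).
Hypothesis jK : forall a, j a%:A = iota a.

Lemma pullback_subfield (F : divringClosed C) :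
  {subset image_field iota <= F} ->
  exists U : {subfield M}, forall z, (z \in U) = (j z \in F).
Proof.
move=> KF; have [|U UE] := @divringClosed_subfield _ M (preim_field j F).
  by move=> a; rewrite inE jK; apply: KF; apply/asboolP; exists a.
by exists U.
Qed.

Lemma sub_image_map_field (U : {subfield M}) : {subset image_field iota <= map_field j U}.
Proof. by move=> _ /asboolP[a <-]; rewrite -jK mem_map_field rpredZ ?rpred1. Qed.

(** An automorphism [f] of [M] gives a second embedding [j \o f], so stability puts the preimages of
    [S] into the inverse image of [A] under [f]. That field contains K too, hence all of [A]. *)
Lemma normalField_pullback (S : C -> Prop) (A : {subfield M}) :
  conjugation_stable S ->
  (forall w, w \in adjoin_field (image_field iota) S <-> w \in map_field j A) ->
  normalField 1 A.
Proof.
move=> stS SA; apply/forall_inP => f _.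
suff : kAut 1 A f by case/andP.
rewrite kAut1E; apply/subvP => _ /memv_imgP[z Az ->].
have memS w : S w -> w \in map_field j A by move=> Sw; apply/SA; apply: gen_adjoin_field.
have /adjoin_field_sub sub : {subset image_field iota <= map_field j (preim_field f A)}.
  move=> _ /asboolP[a <-]; rewrite -jK mem_map_field.
  by change (f a%:A \in A); rewrite rmorph_alg rpredZ ?rpred1.
suff : j z \in map_field j (preim_field f A) by rewrite mem_map_field.
apply: (sub S) => [w Sw|]; last by apply/SA; rewrite mem_map_field.
have /asboolP[y Ay yw] := memS _ Sw; rewrite -yw mem_map_field inE.
rewrite -(mem_map_field j); apply: (memS).
apply: (stS M (in_alg M) j (j \o f)) => //.
- by move=> a; rewrite /= rmorph_alg jK.
- by move=> v /memS/asboolP[x _ <-]; exists x.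
- by rewrite yw.
Qed.

(** As [A] is K(S), L(S) is the compositum of [L] and [A]. For the inclusion of the compositum, L(S)
    is pulled back to a subfield of [M], where [prodv_sub] applies. *)
Lemma adjoin_map_field (S : C -> Prop) (A L : {subfield M}) :
  (forall w, w \in adjoin_field (image_field iota) S <-> w \in map_field j A) ->
  forall w, w \in adjoin_field (map_field j L) S <-> w \in map_field j (L * A)%AS.
Proof.
move=> SA w; split.
  apply: adjoin_field_sub => [_ /asboolP[z Lz <-]|v Sv].
    by rewrite mem_map_field (subvP (field_subvMr L A)).
  have /SA/asboolP[z Az <-] := gen_adjoin_field (image_field iota) Sv.
  by rewrite mem_map_field (subvP (field_subvMl L A)).
have [|U UE] := @pullback_subfield (adjoin_field (map_field j L) S).
  by move=> x Kx; apply: sub_adjoin_field; apply: sub_image_map_field.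
move=> /asboolP[z LAz <-]; rewrite -UE; apply: subvP LAz.
apply: prodv_sub; apply/subvP => x; rewrite UE.
  by move=> Lx; apply: sub_adjoin_field; rewrite mem_map_field.
move=> Ax; have /SA : j x \in map_field j A by rewrite mem_map_field.
apply: adjoin_field_sub => [v Kv|v Sv].
  by apply: sub_adjoin_field; apply: sub_image_map_field.
exact: gen_adjoin_field.
Qed.

End Pullback.

Lemma exists_entangled_field (S T : C -> Prop) (m n l : nat) :
    [pchar K] =i pred0 -> (forall z : C, algebraicOver iota z) ->
    conjugation_stable S -> conjugation_stable T -> prime l ->
    field_degree (image_field iota) (adjoin_field (image_field iota) S) m ->
    field_degree (image_field iota) (adjoin_field (image_field iota) T) n ->
    (l %| gcdn m n)%N ->
  exists L : divringClosed C,
    [/\ {subset image_field iota <= L},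
        {subset L <= adjoin_field (image_field iota) (fun z => S z \/ T z)}
      & group_isom_zmod
          (Defs.gal L (cap_field (adjoin_field L S) (adjoin_field L T))) 'Z_l].
Proof.
move=> char0 algC stS stT pr_l degS degT; rewrite dvdn_gcd => /andP[l_m l_n].
have [bS [_ spanS _]] := degS; have [bT [_ spanT _]] := degT.
(* Having K-bases of K(S) and K(T) in the image of [j] is enough to have both fields there. *)
have [M [j [jK js]]] := splittingField_embedding char0 algC (codom bS ++ codom bT).
have span_range (F : divringClosed C) k (b : 'I_k -> C) :
    (forall i, exists y, j y = b i) ->
    (forall z, z \in F -> exists2 c : 'I_k -> C,
       forall i, c i \in image_field iota & z = \sum_(i < k) c i * b i) ->
    forall w, w \in F -> exists z, j z = w.
  move=> bj span w /span[c Kc ->]; apply/asboolP.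
  suff : \sum_(i < k) c i * b i \in image_field j by [].
  apply: rpred_sum => i _; apply: rpredM; last exact/asboolP/bj.
  by have /asboolP[a <-] := Kc i; apply/asboolP; exists a%:A.
have pull (F : divringClosed C) : {subset image_field iota <= F} ->
    (forall w, w \in F -> exists z, j z = w) ->
    exists A : {subfield M}, forall w, w \in F <-> w \in map_field j A.
  move=> KF Fj; have [A AE] := pullback_subfield jK KF; exists A => w; split.
    by move=> Fw; have [z zw] := Fj w Fw; rewrite -zw mem_map_field AE zw.
  by move=> /asboolP[z Az <-]; rewrite -AE.
have [|A SA] := pull _ (@sub_adjoin_field _ (image_field iota) S).
  by apply: span_range spanS => i; apply: js; rewrite mem_cat codom_f.
have [|B TB] := pull _ (@sub_adjoin_field _ (image_field iota) T).
  by apply: span_range spanT => i; apply: js; rewrite mem_cat codom_f orbT.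
have dimA := field_degree_dimv jK SA degS; have dimB := field_degree_dimv jK TB degT.
have [L [sLAB galL dimL]] := exists_cyclic_entanglement char0 pr_l
  (normalField_pullback jK stS SA) (normalField_pullback jK stT TB)
  (eq_ind_r (fun d => (l %| d)%N) l_m dimA) (eq_ind_r (fun d => (l %| d)%N) l_n dimB).
exists (map_field j L : divringClosed C); split; first exact: sub_image_map_field.
  have [|U UE] := pullback_subfield (M := M) jK
      (F := adjoin_field (image_field iota) (fun z => S z \/ T z)).
    exact: sub_adjoin_field.
  move=> _ /asboolP[z Lz <-]; rewrite -UE; apply: subvP z Lz.
  apply: subv_trans sLAB _; apply: prodv_sub; apply/subvP => x; rewrite UE.
    rewrite -(mem_map_field j) => /SA.
    apply: adjoin_field_sub => [|v Sv]; first exact: sub_adjoin_field.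
    by apply: gen_adjoin_field; left.
  rewrite -(mem_map_field j) => /TB.
  apply: adjoin_field_sub => [|v Tv]; first exact: sub_adjoin_field.
  by apply: gen_adjoin_field; right.
pose F := ((L * A)%AS :&: (L * B)%AS)%AS.
apply: (@gal_isom_Zp K C M j L F) => //.
- move=> w; rewrite inE; split.
    move=> /andP[/(adjoin_map_field jK L SA)/asboolP[y LAy <-]].
    move=> /(adjoin_map_field jK L TB); rewrite mem_map_field => LBy.
    by rewrite mem_map_field; apply/memv_capP.
  move=> /asboolP[y /memv_capP[LAy LBy] <-]; apply/andP; split.
    by apply/(adjoin_map_field jK L SA); rewrite mem_map_field.
  by apply/(adjoin_map_field jK L TB); rewrite mem_map_field.
- by case/and3P: galL.
- by rewrite -galois_dim.
Qed.

End EntangledField.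

(** * Functoriality of torsion points *)

Definition map_point (F C : Type) (f : F -> C) (P : point F) : point C :=
  if P is Affine x y then Affine (f x) (f y) else @Infinity C.

Section PointMorphism.
Variables (F C : fieldType) (f : {rmorphism F -> C}) (E : weierstrass F).

Lemma map_point_inj : injective (map_point f).
Proof. by case=> [|x y] [|x' y'] //= [/fmorph_inj-> /fmorph_inj->]. Qed.

Lemma on_curve_map P : on_curve (base_change f E) (map_point f P) = on_curve E P.
Proof.
case: E P => a1 a2 a3 a4 a6 [|x y] //=.
by rewrite -[RHS](inj_eq (fmorph_inj f)) !(rmorphD, rmorphM, rmorphXn).
Qed.

(** By injectivity of [f] the equality tests select the same branch on both sides, and in each
    branch the law is a rational formula over the coefficients. *)
Lemma add_point_map P Q :
  add_point (base_change f E) (map_point f P) (map_point f Q)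
    = map_point f (add_point E P Q).
Proof.
case: E P Q => a1 a2 a3 a4 a6 [|x1 y1] [|x2 y2] //=.
rewrite -[y1 + _ + _ + _ == 0](fmorph_eq0 f) !(rmorphD, rmorphM) fmorph_eq.
case: ifP => // _ /=.
by case: ifP => _; congr Affine;
  rewrite !(rmorphXn, rmorph_nat, rmorphB, rmorphD, rmorphN, rmorphM, fmorphV).
Qed.

Lemma mul_point_map n P :
  mul_point (base_change f E) n (map_point f P) = map_point f (mul_point E n P).
Proof. by elim: n => //= n IHn; rewrite -add_point_map -IHn. Qed.

Lemma is_torsion_map n P :
  is_torsion (base_change f E) n (map_point f P) <-> is_torsion E n P.
Proof.
rewrite /is_torsion on_curve_map mul_point_map.
by split=> -[-> nP]; split=> //; [apply: map_point_inj|rewrite nP].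
Qed.

End PointMorphism.

Lemma is_torsion_dvd (F : fieldType) (E : weierstrass F) (m n : nat) P :
  (m %| n)%N -> is_torsion E m P -> is_torsion E n P.
Proof.
move=> /dvdnP[k ->] [EP mP]; split=> //.
(* The iteration is back at [Infinity] after [m] additions and simply restarts, so associativity of
   the law does not enter. *)
by elim: k => // k IHk; rewrite mulSn addnC /mul_point iterD -/(mul_point E m P) mP.
Qed.

Lemma base_change_comp (K M C : Type) (g : K -> M) (j : M -> C) (E : weierstrass K) :
  base_change j (base_change g E) = base_change (j \o g) E.
Proof. by case: E. Qed.

(** A torsion point with coordinates in the image of [j] comes from a torsion point over [M] of the
    curve base-changed by [g], and [j'] carries that point to a torsion point of the same curve over
    [C]. *)
Lemma torsion_conjugation_stable (K : fieldType) (C : closedFieldType)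
    (iota : {rmorphism K -> C}) (E : weierstrass K) (n : nat) :
  conjugation_stable iota (torsion_coordinate (base_change iota E) n).
Proof.
move=> M g j j' jg j'g Sj z [x [y [tors zxy]]].
(* Both coordinates of the point must lift to [M], not only the given one. *)
have Sx : torsion_coordinate (base_change iota E) n x by exists x, y; split=> //; left.
have Sy : torsion_coordinate (base_change iota E) n y by exists x, y; split=> //; right.
have [[x1 x1E] [y1 y1E]] := (Sj x Sx, Sj y Sy); subst x y.
have Ej : base_change iota E = base_change j (base_change g E).
  by rewrite base_change_comp; congr base_change; apply/funext => a /=; rewrite jg.
have Ej' : base_change iota E = base_change j' (base_change g E).
  by rewrite base_change_comp; congr base_change; apply/funext => a /=; rewrite j'g.
exists (j' x1), (j' y1); split.
  move: tors; rewrite {1}Ej Ej' => /(is_torsion_map j _ n (Affine x1 y1)) tors.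
  exact/(is_torsion_map j' _ n (Affine x1 y1)).
by case: zxy => /fmorph_inj->; [left|right].
Qed.

Theorem theorem4p3 (K : fieldType) (QtoK : {rmorphism rat -> K})
    (algK : forall x : K, algebraicOver QtoK x)
    (Kbar : closedFieldType) (iota : {rmorphism K -> Kbar})
    (algKbar : forall z : Kbar, algebraicOver iota z)
    (E : elliptic_curve K) (p q l : nat)
    (prime_p : prime p) (prime_q : prime q) (neq_pq : p != q)
    (prime_l : prime l) (dp dq : nat)
    (deg_p : field_degree (image_field iota)
               (torsion_field iota E (image_field iota) p) dp)
    (deg_q : field_degree (image_field iota)
               (torsion_field iota E (image_field iota) q) dq)
    (dvd_l : (l %| gcdn dp dq)%N) :
  exists L : divringClosed Kbar,
    [/\ {subset image_field iota <= L},
        {subset L <= torsion_field iota E (image_field iota) (p * q)}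
      & group_isom_zmod (entanglement_group iota E L p q) 'Z_l].
Proof.
have char0 : [pchar K] =i pred0.
  by move=> r; rewrite (fmorph_pchar QtoK) Num.Theory.pchar_num.
have [L [KL LST isoL]] := exists_entangled_field char0 algKbar
  (@torsion_conjugation_stable _ _ iota E p) (@torsion_conjugation_stable _ _ iota E q)
  prime_l deg_p deg_q dvd_l.
exists L; split=> // z /LST; apply: adjoin_field_sub; first exact: sub_adjoin_field.
move=> w Sw; apply: gen_adjoin_field.
case: Sw => -[x [y [tors wxy]]]; exists x, y; split=> //.
  by apply: is_torsion_dvd tors; apply: dvdn_mulr.
by apply: is_torsion_dvd tors; apply: dvdn_mull.
Qed.
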